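(* Let $p$ be a prime, $k$ a positive integer, $S=\{p,p^k\}$ and $M=\operatorname{ssift}(S)$. If $k$ is odd then \[M=\{n\in\mathbb{N}_+ : \operatorname{val}_p(n)\equiv 0\pmod 2\},\] and if $k$ is even then \[M=\{n\in\mathbb{N}_+ : \operatorname{val}_p(n)\equiv 0,2,4,\dots,k-2\pmod{k+1}\}.\]
   Context: For $S\subseteq\mathbb{N}\setminus\{0,1\}$, the selective sifting $\operatorname{ssift}(S)\subseteq\mathbb{N}_+$ is defined inductively: $1\in\operatorname{ssift}(S)$, and for $n>1$, $n\in\operatorname{ssift}(S)$ if and only if $n$ is not of the form $ab$ with $a\in S$, $b\in\operatorname{ssift}(S)$ and $1\le b<n$. $\operatorname{val}_p(n)=\max\{a: p^a\mid n\}$. *)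

(* Defs.v *)
From Stdlib Require Import Wf_nat.
From mathcomp Require Import all_boot.
From mathcomp Require Import boolp classical_sets.

Set Implicit Arguments.
Unset Strict Implicit.
Unset Printing Implicit Defensive.

Local Open Scope nat_scope.
Local Open Scope classical_set_scope.

(* Membership of n is defined by well-founded recursion on n: [sift b ltbn] is
   the already defined membership of b, available for b < n only.  The defining
   clauses are [ssift1] and [ssiftP] below.  The definition makes sense for
   every S, but is only meant for S not containing 0 or 1. *)
Definition ssift (S : set nat) : set nat :=
  Fix lt_wf (fun=> Prop) (fun n sift =>
    n = 1 \/
    (1 < n /\
     ~ exists a b (ltbn : (b < n)%coq_nat),
         [/\ S a, 1 <= b, sift b ltbn & n = a * b])).

Lemma ssiftE (S : set nat) (n : nat) :
  ssift S n <->
  n = 1 \/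
  (1 < n /\
   ~ exists a b, [/\ S a, ssift S b, 1 <= b < n & n = a * b]).
Proof.
rewrite {1}/ssift Fix_eq -/(ssift S); last first.
  move=> m f g fg; have -> // : f = g.
  by apply: functional_extensionality_dep => x;
     apply: functional_extensionality_dep => y; exact: fg.
suff -> : (exists a b (_ : (b < n)%coq_nat),
            [/\ S a, 1 <= b, ssift S b & n = a * b]) =
          (exists a b, [/\ S a, ssift S b, 1 <= b < n & n = a * b]) by [].
apply: propext; split=> [[a [b [/ltP ltbn [Sa b0 Mb nab]]]]|].
  by exists a, b; rewrite b0 ltbn.
by case=> a [b [Sa Mb /andP[b0 /ltP ltbn] nab]]; exists a, b, ltbn.
Qed.

Lemma ssift_gt0 (S : set nat) (n : nat) : ssift S n -> 0 < n.
Proof. by case/ssiftE=> [->//|[/ltnW]]. Qed.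

Lemma ssift1 (S : set nat) : ssift S 1.
Proof. by apply/ssiftE; left. Qed.

Lemma ssiftP (S : set nat) (n : nat) : 1 < n ->
  ssift S n <-> ~ exists a b, [/\ S a, ssift S b, 1 <= b < n & n = a * b].
Proof.
move=> n1; split=> [/ssiftE[n_1|[]//]|notab]; first by rewrite n_1 in n1.
by apply/ssiftE; right.
Qed.

(* Main.v *)
Require Import Defs.
From mathcomp Require Import all_boot.
From mathcomp Require Import boolp classical_sets.
From mathcomp Require Import zify.

Local Open Scope nat_scope.
Local Open Scope classical_set_scope.

(** When every element of S is a positive power of p, membership of n depends
    only on v = val_p(n): dividing n by p^j in S is the move v -> v - j of a
    subtraction game, and n lies in ssift(S) iff v is a position from which the
    player to move loses.  For S = {p, p^k} the moves are 1 and k, and the set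
    of losing positions is the unique solution of the recurrence
    "v is losing iff no move leads to a losing position". *)

Lemma ssift_powers (p : nat) (J P : set nat) : prime p ->
    (forall j, J j -> 0 < j) ->
    (forall v, P v <-> forall j, J j -> j <= v -> ~ P (v - j)) ->
  ssift [set p ^ j | j in J] = [set n | 0 < n /\ P (logn p n)].
Proof.
move=> p_prime J_gt0 Prec; apply/seteqP.
suff memE n : ssift [set p ^ j | j in J] n <-> 0 < n /\ P (logn p n).
  by split=> n /memE.
have pX_gt0 j : 0 < p ^ j by rewrite expn_gt0 prime_gt0.
elim/ltn_ind: n => -[|[|n]] IHn; first by split=> [/ssift_gt0|[]].
  split=> _; last exact: ssift1.
  (* Valuation 0 admits no move because every [j] in [J] is positive, so [Prec] gives [P 0]. *)
  by split=> //; rewrite logn1; apply/Prec => j /J_gt0; lia.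
set m := n.+2 in IHn *; rewrite ssiftP //; split=> [noab|[_ Pm]].
  split=> //; apply/Prec => j Jj; rewrite -pfactor_dvdn // => /dvdnP[b mE] Pb.
  have b_gt0 : 0 < b by case: b mE {Pb}.
  have ltbm : b < m by rewrite mE ltn_Pmulr // -(expn0 p) ltn_exp2l ?prime_gt1 ?J_gt0.
  apply: noab; exists (p ^ j), b; split; [by exists j| |by rewrite b_gt0|by rewrite mulnC].
  by apply/IHn => //; move: Pb; rewrite mE lognM // pfactorK // addnK.
case=> a [b [[j Jj <-] Mb /andP[b_gt0 ltbm] mE]].
have [_ Pb] := (IHn b ltbm).1 Mb; move: Pm; rewrite mE lognM // pfactorK //.
by move=> /Prec /(_ j Jj (leq_addr _ _)); rewrite addKn.
Qed.

(** Both moves are odd, so each flips the parity of [v]; an odd [v] can always move by 1. *)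
Lemma subtraction_game_odd (k v : nat) : odd k ->
  ~~ odd v <-> forall j, [set 1; k] j -> j <= v -> ~ ~~ odd (v - j).
Proof.
move=> k_odd; split=> [v_even j [->|->] lejv|/(_ 1)]; [lia|lia|].
by case: v => // v /(_ (or_introl erefl) isT); rewrite subn1 /=; lia.
Qed.

(** Modulo [k + 1], the move 1 lowers the residue by one and the move [k] raises it by one. A losing
    residue thus goes to an odd one or, from 0, to [k]; an odd residue reaches a losing one by the
    move 1, and residue [k] reaches 0 by the move [k]. *)
Lemma subtraction_game_even (k v : nat) : 0 < k -> ~~ odd k ->
  ~~ odd (v %% k.+1) && (v %% k.+1 < k) <->
  forall j, [set 1; k] j -> j <= v ->
    ~ (~~ odd ((v - j) %% k.+1) && ((v - j) %% k.+1 < k)).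
Proof.
move=> k_gt0 k_even.
have modE q r : r <= k -> (q * k.+1 + r) %% k.+1 = r.
  by move=> lerk; rewrite modnMDl modn_small.
rewrite (divn_eq v k.+1); move: (v %/ k.+1) (v %% k.+1) (ltn_pmod v (ltn0Sn k)).
move=> {v} q r; rewrite ltnS => lerk; rewrite modE //; split; last first.
  move=> losing; apply/negPn/negP => r_bad.
  have [rk|r_neq_k] := eqVneq r k.
    apply: (losing k) => //; [by right|lia|].
    by rewrite rk addnK -[_ * _]addn0 modE.
  apply: (losing 1) => //; [by left|lia|].
  by rewrite -addnBA ?modE; lia.
case/andP=> r_even ltrk j [->|->] lejv.
  case: r => [|r] in lerk r_even ltrk lejv *; last by rewrite addnS subn1 modE; lia.
  case: q => [|q] in lejv *; first lia.
  have -> : q.+1 * k.+1 + 0 - 1 = q * k.+1 + k by lia.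
  by rewrite modE //; lia.
(* As [r < k], the move [k] is legal only if a whole period can be borrowed. *)
case: q => [|q] in lejv *; first lia.
have -> : q.+1 * k.+1 + r - k = q * k.+1 + r.+1 by lia.
by rewrite modE //; lia.
Qed.

Theorem mainTheorem10 (p k : nat) (p_prime : prime p) (k_gt0 : 0 < k) :
  (odd k ->
    ssift [set p; p ^ k] =
      [set n : nat | 0 < n /\ logn p n = 0 %[mod 2]]) /\
  (~~ odd k ->
    ssift [set p; p ^ k] =
      [set n : nat | 0 < n /\
        exists r : nat,
          [/\ ~~ odd r, r <= k - 2 & logn p n = r %[mod k.+1]]]).
Proof.
have -> : [set p; p ^ k] = [set p ^ j | j in [set 1; k]].
  by rewrite image_setU !image_set1 expn1.
have J_gt0 j : [set 1; k] j -> 0 < j by case=> ->.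
split=> k_par.
  rewrite (ssift_powers p _ [set v | ~~ odd v] p_prime J_gt0); last first.
    by move=> v; exact: subtraction_game_odd.
  by apply/seteqP; split=> n [n_gt0 /= vn]; split=> //; lia.
rewrite (ssift_powers p _ [set v | ~~ odd (v %% k.+1) && (v %% k.+1 < k)]
  p_prime J_gt0); last by move=> v; exact: subtraction_game_even.
apply/seteqP; split=> n [n_gt0 /= vn]; split=> //.
  (* As [k] is even and positive, an even residue below [k] is at most [k - 2], and this subtraction
     does not truncate. *)
  case/andP: vn => r_even ltrk; exists (logn p n %% k.+1).
  by rewrite modn_mod; split=> //; lia.
case: vn => r [r_even lerk ->]; rewrite modn_small; lia.
Qed.
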